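(* Let $p\in[1,+\infty]$, let $M=\sqrt2$, and let $$\Sigma=\left((-\infty,0]\times\{-M\}\right)\cup\left(\{0\}\times[-M,M]\right)\cup\left([0,+\infty)\times\{M\}\right).$$ Then, for every $(z_0,z_1)\in\mathsf X_p$, there exists a unique solution in $\mathsf X_p$ of the wave equation associated with $\Sigma$ with initial condition $(z_0,z_1)$.
   Context: Notation: $\mathbb R_+=[0,+\infty)$. $L^p_{\mathrm{loc}}(a,+\infty)$ is the set of measurable functions whose restriction to $(a,T)$ is in $L^p$ for every $T>a$. $W^{1,p}_*(0,1)=\{u\in L^p(0,1): u'\in L^p(0,1),\ u(0)=0\}$ and $\mathsf X_p=W^{1,p}_*(0,1)\times L^p(0,1)$. The wave equation associated with $\Sigma$ is: $z_{tt}=z_{xx}$ on $\mathbb R_+\times[0,1]$; $z(t,0)=0$ and $(z_t(t,1),-z_x(t,1))\in\Sigma$ for $t\in\mathbb R_+$; $z(0,x)=z_0(x)$, $z_t(0,x)=z_1(x)$ for $x\in[0,1]$. A (weak, global in time) solution in $\mathsf X_p$ with initial condition $(z_0,z_1)\in\mathsf X_p$ is a function $z:\mathbb R_+\times[0,1]\to\mathbb R$ for which there exist $f\in L^p_{\mathrm{loc}}(0,+\infty)$ and $g\in L^p_{\mathrm{loc}}(-1,+\infty)$ such that $z(t,x)=\frac1{\sqrt2}\int_0^{t+x}f+\frac1{\sqrt2}\int_0^{t-x}g$ for all $(t,x)\in\mathbb R_+\times[0,1]$, $z(t,0)=0$ and $(z_t(t,1),-z_x(t,1))\in\Sigma$ for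 a.e. $t\in\mathbb R_+$, and $z(0,x)=z_0(x)$, $z_t(0,x)=z_1(x)$ for a.e. $x\in[0,1]$; here $z_t(t,x)=\frac{f(t+x)+g(t-x)}{\sqrt2}$ and $z_x(t,x)=\frac{f(t+x)-g(t-x)}{\sqrt2}$. *)

(* Defs.v *)
From HB Require Import structures.
From mathcomp Require Import all_boot all_order all_algebra.
From mathcomp Require Import all_classical all_reals all_analysis.

Set Implicit Arguments.
Unset Strict Implicit.
Unset Printing Implicit Defensive.

Import Order.TTheory GRing.Theory Num.Theory.
Import numFieldNormedType.Exports.

Local Open Scope classical_set_scope.
Local Open Scope ring_scope.

(* Elements of L^p are handled through (Borel) representatives R -> R; a
   function on D is a total function whose values outside D are irrelevant:
   [f \_ D] is f on D and 0 elsewhere. *)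
Definition Lp_on (R : realType) (p : \bar R) (D : set R) (f : R -> R) : Prop :=
  (f \_ D) \in Lfun (@lebesgue_measure R) p.

Definition Lp_loc (R : realType) (p : \bar R) (a : R) (f : R -> R) : Prop :=
  measurable_fun `]a, +oo[ f /\ forall T : R, a < T -> Lp_on p `]a, T[ f.

(* the space C^oo_c(0,1) *)
Definition test_function (R : realType) (phi : R -> R) : Prop :=
  (forall (n : nat) (x : R), derivable (phi^`(n))%classic x 1) /\
  exists a b : R, [/\ 0 < a, b < 1 &
    forall x : R, x \notin `[a, b] -> phi x = 0].

Definition weak_derivative (R : realType) (u v : R -> R) : Prop :=
  forall phi : R -> R, test_function phi ->
    \int[@lebesgue_measure R]_(x in `]0, 1[) (u x * (phi^`())%classic x) =
    - \int[@lebesgue_measure R]_(x in `]0, 1[) (v x * phi x).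

(* u is only given up to a null set, so the condition u(0) = 0 is a condition
   on its representative that is continuous on [0,1]. *)
Definition W1p_star (R : realType) (p : \bar R) (u : R -> R) : Prop :=
  [/\ Lp_on p `]0, 1[ u,
      exists2 v : R -> R, Lp_on p `]0, 1[ v & weak_derivative u v
    & exists c : R -> R,
      [/\ {within `[0, 1], continuous c},
          {ae @lebesgue_measure R, forall x, x \in `]0, 1[ -> u x = c x}
        & c 0 = 0]].

Definition Xspace (R : realType) (p : \bar R) : set ((R -> R) * (R -> R)) :=
  [set z | W1p_star p z.1 /\ Lp_on p `]0, 1[ z.2].

Definition int_between (R : realType) (f : R -> R) (a b : R) : R :=
  if a <= b then \int[@lebesgue_measure R]_(x in `[a, b]) f x
  else - \int[@lebesgue_measure R]_(x in `[b, a]) f x.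

(* time and space derivatives of
   (t,x) |-> (\int_0^(t+x) f + \int_0^(t-x) g) / sqrt 2 *)
Definition wave_dt (R : realType) (f g : R -> R) (t x : R) : R :=
  (f (t + x) + g (t - x)) / Num.sqrt 2.

Definition wave_dx (R : realType) (f g : R -> R) (t x : R) : R :=
  (f (t + x) - g (t - x)) / Num.sqrt 2.

(* Only the values of z on [0,+oo[ x [0,1] matter. *)
Definition wave_solution (R : realType) (p : \bar R) (Sigma : set (R * R))
    (z0 z1 : R -> R) (z : R -> R -> R) : Prop :=
  exists f g : R -> R,
    [/\ Lp_loc p 0 f /\ Lp_loc p (-1) g,
        forall t x : R, t \in `[0, +oo[ -> x \in `[0, 1] ->
          z t x = (Num.sqrt 2)^-1 * int_between f 0 (t + x) +
                  (Num.sqrt 2)^-1 * int_between g 0 (t - x),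
        {ae @lebesgue_measure R, forall t, t \in `[0, +oo[ ->
          z t 0 = 0 /\ Sigma (wave_dt f g t 1, - wave_dx f g t 1)}
      & {ae @lebesgue_measure R, forall x, x \in `[0, 1] ->
          z 0 x = z0 x /\ wave_dt f g 0 x = z1 x}].

Definition sign_graph (R : realType) (M : R) : set (R * R) :=
  (`]-oo, 0] `*` [set - M]) `|` ([set 0] `*` `[- M, M])
  `|` (`[0, +oo[ `*` [set M]).

(* Main.v *)
Require Import Defs.
From mathcomp Require Import all_boot all_order all_algebra.
From mathcomp Require Import all_classical all_reals all_analysis.
From mathcomp Require Import measurable_realfun ess_sup_inf.
From mathcomp Require Import ring lra.

(** A solution is a superposition of a wave f travelling to the left and a wave g
    travelling to the right. The Dirichlet condition at x = 0 says that g = - f on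
    the positive half-line, so that one function F on ]-1, +oo[, the profile,
    carries all the information: f is F on the positive half-line and g is - F.
    The initial data prescribe F on ]-1, 1[ ([initial_profile]): the derivative of
    the initial position is the even part of F and the initial velocity its odd
    part, up to a factor.

    The boundary condition at x = 1 relates a = f (t + 1) and b = g (t - 1). In the
    coordinates (a, b) the given set, a monotone curve, is rotated by 45 degrees
    and becomes the graph of a piecewise affine function of b
    ([sign_graph_boundary_law]). So the condition reads
    F (t + 1) = boundary_law (F (t - 1)), and F is determined on ]-1, +oo[, step by
    step, by its values on ]-1, 1[. As |boundary_law b| <= |b|, each step keeps F in
    Lp ([profile_iter_Lfun]), and F defines a solution ([profile_wave_solution]).
    Conversely, every solution must follow the same steps, up to null sets
    ([profile_wave_unique]).

    Two facts of real analysis connect the integral formulation with these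
    pointwise relations. An integrable function whose primitive vanishes is 0
    almost everywhere ([primitive_eq0_ae]), by Lebesgue's differentiation theorem.
    A function with a weak derivative v and a continuous representative c is, up to
    the constant c 0, the primitive of v ([weak_derivative_primitive]); this is
    obtained by testing against smooth approximations of indicator functions of
    intervals, built from exp(-1/x). Changes of variable are only needed for
    translations and for the reflection s -> - s, which preserve Lebesgue
    measure. *)

Import Order.TTheory GRing.Theory Num.Theory.
Import numFieldNormedType.Exports.

Local Open Scope classical_set_scope.
Local Open Scope ring_scope.

Set Implicit Arguments.
Unset Strict Implicit.

(** * Measure-preserving maps of the line and almost-everywhere statements *)

Definition preserves_lebesgue (R : realType) (tau : R -> R) : Prop :=
  measurable_fun [set: R] tau /\
  forall A : set R, measurable A ->
    lebesgue_measure (tau @^-1` A) = lebesgue_measure A.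

Section preserves_lebesgue_theory.
Context {R : realType}.
Notation mu := (@lebesgue_measure R).

Lemma ae_imply (P Q : R -> Prop) : (forall x, P x -> Q x) ->
  {ae mu, forall x, P x} -> {ae mu, forall x, Q x}.
Proof. by move=> PQ; apply: filterS => //; exact: (ae_filter_ringOfSetsType mu). Qed.

Lemma ae_imply2 (P Q S : R -> Prop) : (forall x, P x -> Q x -> S x) ->
  {ae mu, forall x, P x} -> {ae mu, forall x, Q x} -> {ae mu, forall x, S x}.
Proof. by move=> PQS; apply: filterS2 => //; exact: (ae_filter_ringOfSetsType mu). Qed.

Lemma ae_forall_nat (P : nat -> R -> Prop) :
  (forall n, {ae mu, forall x, P n x}) -> {ae mu, forall x, forall n, P n x}.
Proof. by move=> aeP; apply/ae_foralln. Qed.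

(** Lebesgue measure is the only measure giving each half-open interval its
    length, so it is enough to test the pushforward on these intervals. *)
Lemma preserves_lebesgueP (tau : R -> R) :
  measurable_fun [set: R] tau ->
  (forall a b : R, a <= b -> mu (tau @^-1` `]a, b]) = (b - a)%:E) ->
  preserves_lebesgue tau.
Proof.
move=> mtau tauE; split=> // A mA.
suff : pushforward mu (tau : _ -> measurableTypeR R) A = mu A by [].
apply/esym/lebesgue_measure_unique => //= _ [[a b]] /= _ <-.
have [ab|ba] := leP a b; last first.
  by rewrite set_itv_ge ?measure0// bnd_simp -leNgt ltW.
rewrite /pushforward [RHS]tauE// lebesgue_measure_itv/= lte_fin lt_neqAle ab andbT.
by case: eqVneq => //= ->; rewrite subrr.
Qed.

Lemma preserves_lebesgue_shift (c : R) : preserves_lebesgue (fun x => x + c).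
Proof.
apply: preserves_lebesgueP => [|a b ab].
  exact: measurable_funD.
rewrite (_ : _ @^-1` _ = [set` `]a - c, b - c]]); last first.
  by apply/seteqP; split=> x /=; rewrite !in_itv/= ltrBlDr lerBrDr.
rewrite lebesgue_measure_itv/= lte_fin ltrD2r lt_neqAle ab andbT.
case: eqVneq => /= [->|_]; first by rewrite subrr.
by rewrite -EFinD; congr (_%:E); ring.
Qed.

Lemma preserves_lebesgue_opp : preserves_lebesgue (fun x : R => - x).
Proof.
apply: preserves_lebesgueP => [|a b ab]; first exact: oppr_measurable.
rewrite (_ : _ @^-1` _ = [set` `[- b, - a[]); last first.
  by apply/seteqP; split=> x /=; rewrite !in_itv/= lerNl ltrNr andbC.
rewrite lebesgue_measure_itv/= lte_fin ltrN2 lt_neqAle ab andbT.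
case: eqVneq => /= [->|_]; first by rewrite subrr.
by rewrite -EFinD; congr (_%:E); ring.
Qed.

Lemma preserves_lebesgue_ae (tau : R -> R) (P : R -> Prop) :
  preserves_lebesgue tau -> {ae mu, forall x, P x} -> {ae mu, forall x, P (tau x)}.
Proof.
move=> [mtau tauE] [N [mN N0 PN]]; exists (tau @^-1` N); split.
- by rewrite -[X in measurable X]setTI; exact: mtau.
- by rewrite -N0; exact: tauE.
- by move=> x /= nPx; apply: PN.
Qed.

Lemma preserves_lebesgue_integral (tau : R -> R) (f : R -> \bar R) :
  preserves_lebesgue tau -> measurable_fun [set: R] f ->
  (forall x, (0 <= f x)%E) ->
  (\int[mu]_x f (tau x) = \int[mu]_x f x)%E.
Proof.
move=> [mtau tauE] mf f0.
transitivity (\int[pushforward mu (tau : _ -> measurableTypeR R)]_x f x)%E.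
  by rewrite ge0_integral_pushforward// preimage_setT.
by apply: eq_measure_integral => A mA _; exact: tauE.
Qed.

(** Integrability transferred between the two sigma-algebra structures carried
    by the line: the canonical one and the one on which [lebesgue_measure] is
    defined are convertible but not syntactically equal, which defeats the
    generic lemmas; hence this lemma and the next one. *)
Lemma integrable_patch (f : R -> R) (D : set R) : measurable D ->
  mu.-integrable setT (EFin \o (f \_ D)) <-> mu.-integrable D (EFin \o f).
Proof.
move=> mD; rewrite -restrict_EFin.
exact (iff_sym (@integrable_mkcond _ (measurableTypeR R) R mu D (EFin \o f) mD)).
Qed.

Lemma integrable_subT (f : R -> \bar R) (D : set R) : measurable D ->
  mu.-integrable setT f -> mu.-integrable D f.
Proof.
by move=> mD; apply: integrableS => //; exact: measurableT.
Qed.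

Lemma preserves_lebesgue_Rintegral (tau : R -> R) (f : R -> R) (D : set R) :
  preserves_lebesgue tau -> measurable D -> mu.-integrable D (EFin \o f) ->
  \int[mu]_(x in tau @^-1` D) f (tau x) = \int[mu]_(x in D) f x.
Proof.
move=> ptau mD intf.
have /(integrable_patch _ mD).2 intg := intf.
have mg : measurable_fun setT (EFin \o f \_ D) by case/integrableP : intg.
rewrite Rintegral_mkcond [RHS]Rintegral_mkcond; congr fine.
rewrite (_ : (fun _ => _) = (EFin \o f \_ D) \o tau); last first.
  apply/funext => x /=; rewrite !patchE.
  by congr (if _ then _ else _)%:E; apply/idP/idP => /set_mem ?; apply/mem_set.
rewrite [LHS]integralE [RHS]integralE; congr (_ - _)%E.
- rewrite funepos_comp.
  by apply: (preserves_lebesgue_integral ptau) => //; exact: measurable_funepos.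
- rewrite funeneg_comp.
  by apply: (preserves_lebesgue_integral ptau) => //; exact: measurable_funeneg.
Qed.

(** * Stability of the spaces Lp *)

Lemma Lfun_preserves_lebesgue (p : \bar R) (tau f : R -> R) : (1 <= p)%E ->
  preserves_lebesgue tau -> f \in Lfun mu p -> (f \o tau) \in Lfun mu p.
Proof.
move=> p1 ptau; rewrite !inE => /andP[]; rewrite !inE /= => mf nf.
apply/andP; split; rewrite inE /=.
  by apply: measurableT_comp => //; case: ptau.
move: nf; rewrite /finite_norm unlock; case: p p1 => [r|//|//] p1.
- suff -> : (\int[mu]_x (`|(EFin \o (f \o tau)) x| `^ r) =
             \int[mu]_x (`|(EFin \o f) x| `^ r))%E by [].
  apply: (@preserves_lebesgue_integral _ (fun x => `|(EFin \o f) x| `^ r)%E ptau);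
    last by move=> x; exact: poweR_ge0.
  apply: (@measurableT_comp _ _ _ _ _ _ (fun x => x `^ r)%E) => //=.
    exact: (measurable_poweR).
  by apply: measurableT_comp => //; exact: measurableT_comp.
- case: ifPn => // mu0 nf.
  apply: le_lt_trans nf; apply/ess_supP.
  have := ess_sup_ge mu (abse \o (EFin \o f)).
  by move/(preserves_lebesgue_ae ptau).
Qed.

Lemma Lfun_dominated (p : \bar R) (f g : R -> R) : (1 <= p)%E ->
  measurable_fun setT f -> (forall x, `|f x| <= `|g x|) ->
  g \in Lfun mu p -> f \in Lfun mu p.
Proof.
move=> p1 mf fg; rewrite !inE => /andP[]; rewrite !inE /= => mg ng.
apply/andP; split; rewrite inE //=.
move: ng; rewrite /finite_norm unlock; case: p p1 => [r|//|//] p1.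
- have r0 : 0 < r by apply: lt_le_trans ltr01 _; rewrite -lee_fin.
  apply: le_lt_trans; rewrite gt0_ler_poweR//.
  + by rewrite invr_ge0 ltW.
  + by rewrite in_itv/= leey integral_ge0// => x _; exact: poweR_ge0.
  + by rewrite in_itv/= leey integral_ge0// => x _; exact: poweR_ge0.
  apply: ge0_le_integral => //.
  + by move=> x _; exact: poweR_ge0.
  + apply: (@measurableT_comp _ _ _ _ _ _ (fun x => x `^ r)%E) => //=.
      exact: measurable_poweR.
    by apply: measurableT_comp => //; exact: measurableT_comp.
  + apply: (@measurableT_comp _ _ _ _ _ _ (fun x => x `^ r)%E) => //=.
      exact: measurable_poweR.
    by apply: measurableT_comp => //; exact: measurableT_comp.
  + move=> x _; apply: gt0_ler_poweR; rewrite ?lee_fin//= ?in_itv/= ?leey ?andbT ?lee_fin//.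
    exact: ltW.
- case: ifPn => // mu0; apply: le_lt_trans; apply: le_ess_sup.
  by apply: nearW => x /=; rewrite lee_fin.
Qed.

Lemma Lfun_add (p : \bar R) (f g : R -> R) : (1 <= p)%E ->
  f \in Lfun mu p -> g \in Lfun mu p -> (fun x => f x + g x) \in Lfun mu p.
Proof.
move=> p1 fL gL; have [_ addL] := @Lfun_addr_closed _ _ R mu p p1.
exact: addL fL gL.
Qed.

Lemma Lfun_mull (p : \bar R) (f : R -> R) (a : R) : (1 <= p)%E ->
  f \in Lfun mu p -> (fun x => a * f x) \in Lfun mu p.
Proof.
move=> p1 fL; have [L0 linL] := @Lfun_submod_closed _ _ R mu p p1.
rewrite (_ : (fun x => _) = a *: f + 0); first exact: linL.
by rewrite addr0.
Qed.

(** On a set of finite measure, |f| is at most 1 + |f|^p when p is finite, and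
    at most an almost-everywhere bound of f when p is infinite; in both cases
    the majorant is integrable. *)
Lemma Lfun_integrable_finite (p : \bar R) (f : R -> R) (D : set R) : (1 <= p)%E ->
  measurable D -> (mu D < +oo)%E ->
  f \in Lfun mu p -> mu.-integrable D (EFin \o f).
Proof.
move=> p1 mD Doo fp; have mf : measurable_fun setT f.
  by move: fp; rewrite inE => /andP[]; rewrite inE.
have mfD : measurable_fun D (EFin \o f).
  by apply/measurable_EFinP; exact: measurable_funTS.
have icst (r : R) : mu.-integrable D (EFin \o cst r).
  by apply: measurable_bounded_integrable => //; exact: bounded_cst.
case: p p1 fp => [r|//|//] p1 fp.
- have ifr : mu.-integrable D (fun x => (`|f x| `^ r)%:E).
    by apply: integrableS (Lfun_integrable p1 fp).
  apply: (le_integrable _ _ _ (integrableD _ (icst 1) ifr)) => //.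
  move=> x _ /=; rewrite lee_fin [leRHS]ger0_norm ?addr_ge0 ?powR_ge0//.
  have [f1|f1] := lerP `|f x| 1.
    by rewrite ler_wpDr// powR_ge0.
  by rewrite ler_wpDl// -[leLHS]powRr1// ler_powR// ltW.
- move: fp; rewrite inE => /andP[_]; rewrite inE /= /finite_norm unlock.
  have muT : (0 < @lebesgue_measure R [set: R])%E.
    apply: (@lt_le_trans _ _ (lebesgue_measure `]0%R, 1%R])).
      by rewrite lebesgue_measure_itv/= lte01 sube0.
    by apply: le_measure; rewrite ?inE.
  rewrite ifT; last exact: muT.
  move=> ess.
  have [M fM] : exists M : R, {ae mu, forall x, `|f x| <= M}.
    move: ess (ess_sup_ge mu (abse \o (EFin \o f))).
    case: (ess_sup _ _) => [M|//|] _ fM.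
      by exists M; apply: filterS fM => x /=; rewrite lee_fin.
    by exists 0; apply: filterS fM => x /=.
  apply/integrableP; split=> //.
  apply: le_lt_trans (_ : (\int[mu]_(x in D) (cst `|M|%:E x) < +oo))%E.
    apply: ae_ge0_le_integral => //; first exact: measurableT_comp.
      by move=> x _; rewrite lee_fin.
    move: fM; apply: ae_imply => x /= fM _; rewrite lee_fin (le_trans fM)//.
    exact: ler_norm.
  by rewrite integral_cst// lte_mul_pinfty// lee_fin.
Qed.

End preserves_lebesgue_theory.

(** * A smooth step function *)

Section smooth_step.
Context {R : realType}.
Implicit Types (P : {poly R}) (f g : R -> R).

(** With the constant polynomial 1 this is the classical exp(-1/x) extended by 0.
    The family is indexed by a polynomial so that it is closed under
    derivation. *)
Definition flat P (x : R) : R := if 0 < x then P.[x^-1] * expR (- x^-1) else 0.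

(** The factor y^n makes the induction on the polynomial work: multiplying by
    the variable only raises n. *)
Lemma poly_le_expR P : exists C : R, forall y, 0 <= y -> `|P.[y]| <= C * expR y.
Proof.
suff H n : exists C : R, forall y, 0 <= y -> `|y ^+ n * P.[y]| <= C * expR y.
  have [C HC] := H 0; exists C => y y0.
  by rewrite -[P.[y]]mul1r; exact: HC.
elim/poly_ind: P n => [|P c IH] n.
  by exists 0 => y _; rewrite horner0 mulr0 normr0 mul0r.
have [C HC] := IH n.+1.
exists (C + `|c| * n`!%:R) => y y0.
rewrite hornerMXaddC mulrDr (le_trans (ler_normD _ _))// mulrDl lerD//.
  by rewrite mulrA mulrAC -exprSr HC.
rewrite normrM mulrC -mulrA ler_wpM2l// ger0_norm ?exprn_ge0//.
case: n {IH HC} => [|n].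
  by rewrite expr0 fact0 mul1r (le_trans _ (expR_ge1Dx _))// lerDl.
rewrite mulrC -ler_pdivrMr ?ltr0n ?fact_gt0//.
by rewrite (le_trans _ (expR_ge1Dxn n y0))// lerDr.
Qed.

(** Away from 0 this is the chain rule. At 0 the difference quotient for h > 0 is
    h times (y^2 P(y) exp(-y)) with y = 1/h; the second factor is bounded, since
    the exponential dominates polynomials. *)
Lemma is_derive_flat P (x : R) :
  is_derive x (1 : R) (flat P) (flat ('X^2 * (P - P^`())) x).
Proof.
have [x0|x0|->] := ltgtP x 0.
- apply: (@near_eq_is_derive R R^o R^o (cst 0)).
  + by near=> y; rewrite /flat ltNge ltW//; near: y; exact: lt_nbhsl.
  + by rewrite /flat ltNge (ltW x0); exact: is_derive_cst.
- apply: (@near_eq_is_derive R R^o R^o (fun y : R => P.[y^-1] * expR (- y^-1))).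
    near=> y; rewrite /flat ifT//; near: y; exact: lt_nbhsr.
  have xinv : is_derive x (1:R) (fun y : R => y^-1) (- x ^- 2).
    have := @is_deriveV R id x 1 1; rewrite /= => H.
    apply: is_derive_eq; first by apply: H; rewrite ?gt_eqF//.
    by rewrite scaler1.
  have dP := @is_derive1_comp _ (horner P) _ x _ _ (is_derive_poly P x^-1) xinv.
  have dE := @is_derive1_comp _ expR _ x _ _ (is_derive_expR (- x^-1)) (is_deriveN xinv).
  have dM := is_deriveM dP dE.
  rewrite /flat x0; apply: is_derive_eq.
  by rewrite /= !hornerE /GRing.scale/= -exprVn; ring.
- have [C HC] := poly_le_expR ('X^2 * P).
  have C0 : 0 <= C.
    by have := HC 0 (lexx 0); rewrite expR0 mulr1; apply: le_trans.
  have lim0 : (fun h : R => h^-1 *: ((flat P \o shift 0) (h *: (1 : R)) - flat P 0))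
      @ 0^' --> (0 : R).
    apply/cvgrPdist_le => e e0; near=> h.
    rewrite sub0r normrN /= [X in flat P X](_ : _ = h); last first.
      by rewrite addr0 /GRing.scale/= mulr1.
    rewrite {2}/flat ltxx subr0 /flat; case: ifPn => [h0|_]; last first.
      by rewrite scaler0 normr0 ltW.
    rewrite /GRing.scale/=.
    have -> : h^-1 * (P.[h^-1] * expR (- h^-1)) =
              h * (('X^2 * P).[h^-1] / expR h^-1).
      by rewrite hornerM hornerXn -expRN; field; rewrite gt_eqF.
    rewrite normrM gtr0_norm// (le_trans (_ : _ <= h * C))//.
      rewrite ler_wpM2l ?(ltW h0)// normrM normfV (gtr0_norm (expR_gt0 _)).
      by rewrite ler_pdivrMr ?expR_gt0// HC// invr_ge0 ltW.
    (* C + 1 rather than C, which may vanish *)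
    have hC : h * (C + 1) <= e.
      rewrite -ler_pdivlMr ?ltr_wpDl// -[leLHS]gtr0_norm// ltW//; near: h.
      by apply: dnbhs0_lt; rewrite divr_gt0// ltr_wpDl.
    by rewrite (le_trans _ hC)// ler_wpM2l ?(ltW h0)// lerDl.
  rewrite {2}/flat ltxx; apply: DeriveDef; first exact: cvgP lim0.
  exact: (cvg_lim _ lim0).
Unshelve. all: by end_near. Qed.

(** A syntactic class of functions closed under derivation: every member is
    therefore infinitely differentiable, without any induction on the order of
    the derivative for products, inverses or compositions. *)
Inductive smooth_term : (R -> R) -> Prop :=
| smooth_flat P : smooth_term (flat P)
| smooth_cst c : smooth_term (cst c)
| smooth_add f g : smooth_term f -> smooth_term g -> smooth_term (f \+ g)
| smooth_mul f g : smooth_term f -> smooth_term g -> smooth_term (f \* g)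
| smooth_inv f : smooth_term f -> (forall x, f x != 0) ->
    smooth_term (fun x => (f x)^-1)
| smooth_affine f a b : smooth_term f -> smooth_term (fun x => f (a * x + b)).

Lemma smooth_term_derive f : smooth_term f ->
  exists2 df, smooth_term df & forall x, is_derive x (1 : R) f (df x).
Proof.
elim=> {f}.
- by move=> P; exists (flat ('X^2 * (P - P^`()))); [exact: smooth_flat|exact: is_derive_flat].
- by move=> c; exists (cst 0); [exact: smooth_cst|move=> x; exact: is_derive_cst].
- move=> f g _ [df sdf Hf] _ [dg sdg Hg]; exists (df \+ dg); first exact: smooth_add.
  by move=> x; exact: is_deriveD.
- move=> f g sf [df sdf Hf] sg [dg sdg Hg].
  exists ((f \* dg) \+ (g \* df)); first by apply: smooth_add; apply: smooth_mul.
  by move=> x; exact: is_deriveM.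
- move=> f sf [df sdf Hf] f0.
  exists (cst (-1) \* (((fun x => (f x)^-1) \* (fun x => (f x)^-1)) \* df)).
    apply: smooth_mul; first exact: smooth_cst.
    by apply: smooth_mul => //; apply: smooth_mul; apply: smooth_inv.
  move=> x; have dV := is_deriveV (f0 x) (Hf x).
  by apply: is_derive_eq; rewrite /GRing.scale/= expr2 invfM; ring.
- move=> f a b sf [df sdf Hf].
  exists (cst a \* (fun x => df (a * x + b))).
    by apply: smooth_mul; [exact: smooth_cst|exact: smooth_affine].
  move=> x; have dA : is_derive x 1 (fun y => a * y + b) a.
    by apply: is_derive_eq; rewrite addr0 /GRing.scale/= mulr1.
  have dC := @is_derive1_comp _ f _ x _ _ (Hf (a * x + b)) dA.
  by apply: is_derive_eq; rewrite mulrC.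
Qed.

Lemma smooth_term_derivable f n x : smooth_term f -> derivable (f^`(n))%classic x 1.
Proof.
elim: n f x => [|n IH] f x /smooth_term_derive[df sdf Hf].
  by rewrite derive1n0; apply: ex_derive.
rewrite derive1Sn (_ : (f^`())%classic = df); first exact: IH.
by apply/funext => y; rewrite derive1E; case: (Hf y).
Qed.

Lemma smooth_term_derive1 f : smooth_term f -> smooth_term (f^`())%classic.
Proof.
move=> /smooth_term_derive[df sdf Hf].
rewrite (_ : (f^`())%classic = df) //.
by apply/funext => y; rewrite derive1E; case: (Hf y).
Qed.

Lemma smooth_term_continuous f : smooth_term f -> continuous f.
Proof.
move=> sf x; apply/differentiable_continuous/derivable1_diffP.
exact: (@smooth_term_derivable f 0).
Qed.

Definition step (x : R) : R := flat 1 x / (flat 1 x + flat 1 (1 - x)).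

Lemma flat1_ge0 (x : R) : 0 <= flat 1 x.
Proof. by rewrite /flat; case: ifP => // _; rewrite hornerC mul1r expR_ge0. Qed.

Lemma flat1_gt0 (x : R) : 0 < x -> 0 < flat 1 x.
Proof. by move=> x0; rewrite /flat x0 hornerC mul1r expR_gt0. Qed.

Lemma step_denom_gt0 (x : R) : 0 < flat 1 x + flat 1 (1 - x).
Proof.
have [x0|x0] := ltP 0 x; first by rewrite ltr_wpDr ?flat1_ge0 ?flat1_gt0.
by rewrite ltr_wpDl ?flat1_ge0 ?flat1_gt0//; lra.
Qed.

Lemma step_le0 (x : R) : x <= 0 -> step x = 0.
Proof. by move=> x0; rewrite /step {1}/flat ltNge x0 mul0r. Qed.

Lemma step_ge1 (x : R) : 1 <= x -> step x = 1.
Proof.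
move=> x1; rewrite /step [flat 1 (1 - x)]/flat ifF ?addr0; last first.
  by apply/negbTE; rewrite -leNgt; lra.
by rewrite divff// gt_eqF// flat1_gt0//; lra.
Qed.

Lemma step_ge0_le1 (x : R) : 0 <= step x <= 1.
Proof.
apply/andP; split; first by rewrite divr_ge0 ?flat1_ge0 ?ltW ?step_denom_gt0.
by rewrite ler_pdivrMr ?step_denom_gt0// mul1r lerDl flat1_ge0.
Qed.

Lemma smooth_step : smooth_term step.
Proof.
apply: smooth_mul; first exact: smooth_flat.
apply: smooth_inv => [|x]; last by rewrite gt_eqF// step_denom_gt0.
apply: smooth_add; first exact: smooth_flat.
rewrite (_ : (fun x => _) = (fun x => flat 1 (-1 * x + 1))).
  by apply: smooth_affine; exact: smooth_flat.
by apply/funext => x; congr flat; ring.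
Qed.

Lemma derive1_step_out (x : R) : x < 0 \/ 1 < x -> (step^`())%classic x = 0.
Proof.
move=> x01; rewrite derive1E.
suff : is_derive x 1 step (0 : R) by case.
case: x01 => [x0|x1].
- apply: (@near_eq_is_derive R R^o R^o (cst 0)).
  by near=> y; rewrite step_le0// ltW//; near: y; exact: lt_nbhsl.
- apply: (@near_eq_is_derive R R^o R^o (cst 1)).
  by near=> y; rewrite step_ge1// ltW//; near: y; exact: lt_nbhsr.
Unshelve. all: by end_near. Qed.

(** The derivative is continuous, hence bounded on [0, 1], and vanishes elsewhere
    because the step is locally constant there. *)
Lemma derive1_step_bounded :
  exists2 K : R, 0 < K & forall x, `|(step^`())%classic x| <= K.
Proof.
have cs : continuous (step^`())%classic.
  exact/smooth_term_continuous/smooth_term_derive1/smooth_step.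
have /compact_bounded[M [_ HM]] : compact ((step^`())%classic @` [set` `[0, 1]%R]).
  apply: continuous_compact; last exact: segment_compact.
  exact: continuous_subspaceT.
exists (`|M| + 1) => [|x]; first by rewrite ltr_wpDl.
have [x01|] := boolP (x \in `[0, 1]).
  apply: HM; last by exists x.
  by rewrite (le_lt_trans (ler_norm _))// ltrDl.
rewrite in_itv/= negb_and -!ltNge => /orP x01.
by rewrite derive1_step_out// normr0 addr_ge0.
Qed.

End smooth_step.

(** * A function with a weak derivative is the primitive of that derivative *)

Section weak_derivatives.
Context {R : realType}.
Notation mu := (@lebesgue_measure R).

Lemma ae_eq_Rintegral (D : set R) (f g : R -> R) : measurable D ->
  measurable_fun D f -> measurable_fun D g ->
  {ae mu, forall x, D x -> f x = g x} ->
  \int[mu]_(x in D) f x = \int[mu]_(x in D) g x.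
Proof.
move=> mD mf mg fg; congr fine; apply: ae_eq_integral => //.
- exact/measurable_EFinP.
- exact/measurable_EFinP.
- by move: fg; apply: ae_imply => x fg /fg /= ->.
Qed.

Lemma continuous_integrable01 (f : R -> R) : {within `[0, 1], continuous f} ->
  mu.-integrable `]0, 1[ (EFin \o f).
Proof.
move=> cf; have /= := continuous_compact_integrable (@segment_compact _ 0 1) cf.
by apply: integrableS => //; exact: subset_itv_oo_cc.
Qed.

(** Smooth approximations, increasing in sharpness with n, of the indicator
    function of ]a, +oo[; the transition takes place in [a, a + 1/(n+1)]. *)
Definition ramp (a : R) (n : nat) (x : R) : R := step (n.+1%:R * (x - a)).

Lemma smooth_ramp a n : smooth_term (ramp a n).
Proof.
rewrite (_ : ramp a n = fun x => step (n.+1%:R * x + - (n.+1%:R * a))).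
  by apply: smooth_affine; exact: smooth_step.
by apply/funext => x; rewrite /ramp mulrBr.
Qed.

Lemma ramp_le a n x : x <= a -> ramp a n x = 0.
Proof. by move=> xa; rewrite /ramp step_le0// mulr_ge0_le0// subr_le0. Qed.

Lemma ramp_ge a n x : a + n.+1%:R^-1 <= x -> ramp a n x = 1.
Proof.
move=> xa; rewrite /ramp step_ge1// mulrC -ler_pdivrMr// div1r lerBrDl//.
Qed.

Lemma ramp_bounded a n x : `|ramp a n x| <= 1.
Proof. by have /andP[r0 r1] := step_ge0_le1 (n.+1%:R * (x - a)); rewrite ger0_norm. Qed.

Lemma continuous_ramp a n : continuous (ramp a n).
Proof. exact/smooth_term_continuous/smooth_ramp. Qed.

Lemma continuous_derive1_ramp a n : continuous ((ramp a n)^`())%classic.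
Proof. exact/smooth_term_continuous/smooth_term_derive1/smooth_ramp. Qed.

Lemma derive1_ramp a n x :
  ((ramp a n)^`())%classic x = (step^`())%classic (n.+1%:R * (x - a)) * n.+1%:R.
Proof.
have dA : is_derive x 1 (fun y : R => n.+1%:R * (y - a)) (n.+1%:R : R).
  by apply: is_derive_eq; rewrite subr0 /GRing.scale/= mulr1.
have ds : derivable step (n.+1%:R * (x - a)) 1.
  exact: (@smooth_term_derivable _ step 0 _ smooth_step).
have [_ dC] := @is_derive1_comp _ step _ x _ _ (derivableP ds) dA.
by rewrite !derive1E -dC.
Qed.

Lemma Rintegral_derive1_ramp a n : 0 < a -> a + n.+1%:R^-1 <= 1 ->
  \int[mu]_(x in `]0, 1[) ((ramp a n)^`())%classic x = 1.
Proof.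
move=> a0 an1.
have dR x : derivable (ramp a n) x 1.
  exact: (@smooth_term_derivable _ (ramp a n) 0 _ (smooth_ramp a n)).
have ci : mu.-integrable `[0, 1] (EFin \o ((ramp a n)^`())%classic).
  apply: continuous_compact_integrable; first exact: segment_compact.
  exact/continuous_subspaceT/continuous_derive1_ramp.
rewrite Rintegral_itv_bndo_bndc; last first.
  by apply: integrableS ci => //; exact: subset_itv_oo_cc.
rewrite Rintegral_itv_obnd_cbnd; last first.
  by apply: integrableS ci => //; exact: subset_itv_oc_cc.
transitivity (fine ((ramp a n 1)%:E - (ramp a n 0)%:E)%E).
  congr fine; apply: continuous_FTC2; first exact: ltr01.
  - exact/continuous_subspaceT/continuous_derive1_ramp.
  - split => [x _||]; first exact: dR.
    + by apply: cvg_at_right_filter; exact: continuous_ramp.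
    + by apply: cvg_at_left_filter; exact: continuous_ramp.
  - by [].
by rewrite (ramp_ge an1) (ramp_le _ (ltW a0)) sube0.
Qed.

(** The derivatives of the ramps form an approximate identity at a: they have
    mass 1, are supported in [a, a + 1/(n+1)] and are bounded by K (n+1), where K
    bounds the derivative of the step. Hence their L1 norm is at most K, and the
    oscillation of c near a controls the error. *)
Lemma derive1_ramp_delta (c : R -> R) (a : R) : 0 < a < 1 ->
  {within `[0, 1], continuous c} ->
  \int[mu]_(x in `]0, 1[) (c x * ((ramp a n)^`())%classic x) @[n --> \oo] --> c a.
Proof.
move=> /andP[a0 a1] cc; have [K K0 HK] := @derive1_step_bounded R.
have ca : {for a, continuous c}.
  by have /(continuous_within_itvP _ ltr01)[+ _ _] := cc; apply; rewrite in_itv/= a0.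
apply/cvgrPdist_le => e e0.
have eK : 0 < e / K by rewrite divr_gt0.
(* an oscillation e / K compensates the L1 norm K *)
have [d /= d0 Hd] : exists2 d, 0 < d & forall x, `|a - x| < d -> `|c a - c x| <= e / K.
  move/cvgrPdist_le : ca => /(_ _ eK) [d /= d0 Hd]; exists d => // x; exact: Hd.
have a1' : 0 < 1 - a by rewrite subr_gt0.
near=> n.
have n0 : 0 < n.+1%:R^-1 :> R by rewrite invr_gt0.
have an1 : a + n.+1%:R^-1 < 1.
  by rewrite -ltrBrDl; near: n; exact: near_infty_natSinv_lt (PosNum a1').
have nd : n.+1%:R^-1 < d.
  by near: n; exact: near_infty_natSinv_lt (PosNum d0).
set T := ((ramp a n)^`())%classic.
have cT : continuous T by exact: continuous_derive1_ramp.
have icT : mu.-integrable `]0, 1[ (EFin \o (fun x => c x * T x)).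
  apply: continuous_integrable01 => x; apply: continuousM; first exact: cc.
  exact: (continuous_subspaceT cT).
have iT : mu.-integrable `]0, 1[ (EFin \o (fun x => c a * T x)).
  apply: continuous_integrable01; apply: continuous_subspaceT => x.
  by apply: continuousM; [exact: cst_continuous|exact: cT].
pose J : set R := [set` `[a, a + n.+1%:R^-1]].
pose B := e / K * (K * n.+1%:R).
have TB x : `|(c a - c x) * T x| <= ((cst B) \_ J) x.
  rewrite patchE; case: ifPn => [|] xJ.
    rewrite normrM ler_pM//.
      move: xJ; rewrite inE /J/= in_itv/= => /andP[ax xa].
      by apply: Hd; rewrite distrC ger0_norm ?subr_ge0// ltrBlDl (le_lt_trans xa)// ltrD2l.
    by rewrite /T derive1_ramp normrM [X in _ * X]ger0_norm// ler_wpM2r// HK.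
  rewrite /T derive1_ramp derive1_step_out ?mul0r ?mulr0 ?normr0//.
  move: xJ; rewrite notin_setE /J/= in_itv/= => /negP; rewrite negb_and -!ltNge => /orP[xa|ax].
    by left; rewrite pmulr_rlt0// subr_lt0.
  by right; rewrite mulrC -ltr_pdivrMr// div1r ltrBrDl.
have -> : c a - \int[mu]_(x in `]0, 1[) (c x * T x) =
          \int[mu]_(x in `]0, 1[) ((c a - c x) * T x).
  transitivity (\int[mu]_(x in `]0, 1[) (c a * T x - c x * T x)).
    rewrite RintegralB// RintegralZl// ?Rintegral_derive1_ramp ?mulr1 ?ltW//.
    exact/continuous_integrable01/continuous_subspaceT.
  by apply: eq_Rintegral => x _; rewrite mulrBl.
have iB : mu.-integrable `]0, 1[ (EFin \o ((cst B) \_ J)).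
  have iJ : mu.-integrable J (EFin \o cst B).
    apply: continuous_compact_integrable; first exact: segment_compact.
    exact/continuous_subspaceT/cst_continuous.
  have iP := (integrable_patch (cst B) (measurable_itv _)).2 iJ.
  exact: integrable_subT iP.
have iD : mu.-integrable `]0, 1[ (EFin \o (fun x => (c a - c x) * T x)).
  apply: eq_integrable (integrableB _ iT icT) => // x _ /=.
  by rewrite -EFinB mulrBl.
apply: (le_trans (le_normr_Rintegral _ _)) => //.
apply: (@le_trans _ _ (\int[mu]_(x in `]0, 1[) ((cst B) \_ J) x)).
  apply: le_Rintegral => //.
  exact: integrable_norm.
rewrite -Rintegral_mkcondr setIidr; last first.
  move=> x; rewrite /J/= !in_itv/= => /andP[ax xa].
  by rewrite (lt_le_trans a0 ax) (le_lt_trans xa).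
have muJ : @lebesgue_measure R J = (n.+1%:R^-1)%:E.
  by rewrite /J lebesgue_measure_itv/= lte_fin ltrDl n0/= -EFinD addrAC subrr add0r.
have -> : \int[mu]_(x in J) B = B * n.+1%:R^-1.
  by rewrite Rintegral_cst; [rewrite -[n.+1%:R^-1 in RHS]/(fine (n.+1%:R^-1)%:E) -muJ|exact: measurable_itv].
by rewrite /B mulrA divfK ?gt_eqF// -mulrA divff ?mulr1.
Unshelve. all: by end_near. Qed.

Lemma ramp_cvg (a x : R) : ramp a n x @[n --> \oo] --> (((a < x)%R)%:R : R).
Proof.
have [ax|xa] := ltP a x; last first.
  by under eq_cvg do rewrite ramp_le//; exact: cvg_cst.
apply/cvgrPdist_le => e e0; near=> n.
rewrite ramp_ge; first by rewrite subrr normr0 ltW.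
rewrite -lerBrDl ltW//; near: n.
have xa : 0 < x - a by rewrite subr_gt0.
exact: near_infty_natSinv_lt (PosNum xa).
Unshelve. all: by end_near. Qed.

Lemma integral_ramp_cvg (v : R -> R) (a : R) : 0 <= a -> a <= 1 ->
  mu.-integrable `]0, 1[ (EFin \o v) ->
  \int[mu]_(x in `]0, 1[) (v x * ramp a n x) @[n --> \oo] -->
  \int[mu]_(x in `]a, 1[) v x.
Proof.
move=> a0 a1 iv.
have mv : measurable_fun `](0 : R), 1[ v by apply/measurable_EFinP; case/integrableP : iv.
have mr n : measurable_fun `](0 : R), 1[ (ramp a n).
  by apply: measurable_funTS; apply: continuous_measurable_fun; exact: continuous_ramp.
have mi : measurable_fun `](0 : R), 1[ (fun x => (((a < x)%R)%:R : R)).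
  by apply: measurable_fun_cvg mr _ => x _; exact: ramp_cvg.
have [|||||ilim _ lim] := @dominated_convergence _ _ _ mu `](0 : R)%R, 1%R[%classic
  (measurable_itv _) (fun n x => (v x * ramp a n x)%:E)
  (fun x => (v x * ((a < x)%R)%:R)%:E) (fun x => `|(v x)%:E|%E).
- by move=> n; apply/measurable_EFinP; exact: (measurable_funM mv (mr n)).
- by apply/measurable_EFinP; exact: measurable_funM.
- apply: aeW => x _; apply: cvg_EFin; first exact: nearW.
  by apply: cvgM; [exact: cvg_cst|exact: ramp_cvg].
- exact: integrable_abse iv.
- apply: aeW => x n _ /=; rewrite lee_fin normrM.
  by rewrite ler_piMr// ramp_bounded.
have -> : \int[mu]_(x in `]a, 1[) v x = \int[mu]_(x in `]0, 1[) (v x * ((a < x)%R)%:R).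
  rewrite (_ : [set` `]a, 1[] = [set` `]0, 1[] `&` [set` `]a, +oo[]).
    rewrite Rintegral_mkcondr; apply: eq_Rintegral => x _.
    rewrite patchE; case: ifPn => xa.
      by move: xa; rewrite inE/= in_itv/= andbT => ->; rewrite mulr1.
    by move: xa; rewrite notin_setE/= in_itv/= andbT => /negP/negbTE ->; rewrite mulr0.
  apply/seteqP; split => x /=; rewrite !in_itv/= andbT.
    by move=> /andP[ax ->]; rewrite ax (le_lt_trans a0).
  by move=> [/andP[_ ->] ->].
rewrite /Rintegral; apply: fine_cvg; rewrite fineK; first exact: lim.
exact: integrable_fin_num ilim.
Qed.

(** These test functions approximate the indicator function of ]a, b]; beyond
    b + 1/(n+1) the two ramps are both 1 and cancel. *)
Lemma test_function_ramp (a b : R) (n : nat) : 0 < a -> a <= b ->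
  b + n.+1%:R^-1 < 1 -> test_function (fun x => ramp a n x - ramp b n x).
Proof.
move=> a0 ab bn1; split.
  move=> m x; apply: smooth_term_derivable.
  rewrite (_ : (fun _ => _) = ramp a n \+ (cst (-1) \* ramp b n)).
    apply: smooth_add; first exact: smooth_ramp.
    by apply: smooth_mul; [exact: smooth_cst|exact: smooth_ramp].
  by apply/funext => y /=; rewrite mulN1r.
exists a, (b + n.+1%:R^-1); split=> // x; rewrite in_itv/= negb_and -!ltNge.
case/orP=> [xa|bx].
  by rewrite !ramp_le ?subrr ?ltW// (lt_le_trans xa).
rewrite !ramp_ge ?subrr ?ltW//; apply: le_lt_trans bx.
by rewrite lerD2r.
Qed.

(** Test the weak derivative against the difference of the ramps at a and b and
    let n tend to infinity: the side of c converges by continuity, the side of v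
    by dominated convergence. *)
Lemma weak_derivative_ramp (u v c : R -> R) (a b : R) :
  mu.-integrable `]0, 1[ (EFin \o u) -> mu.-integrable `]0, 1[ (EFin \o v) ->
  {within `[0, 1], continuous c} ->
  {ae mu, forall x, x \in `]0, 1[ -> u x = c x} ->
  weak_derivative u v -> 0 < a -> a <= b -> b < 1 ->
  c a - c b = - (\int[mu]_(x in `]a, 1[) v x - \int[mu]_(x in `]b, 1[) v x).
Proof.
move=> iu iv cc uc uv a0 ab b1.
have a1 := le_lt_trans ab b1; have b0 := lt_le_trans a0 ab.
have lhs : (\int[mu]_(x in `]0, 1[) (c x * ((ramp a n)^`())%classic x) -
            \int[mu]_(x in `]0, 1[) (c x * ((ramp b n)^`())%classic x))
    @[n --> \oo] --> c a - c b.
  by apply: cvgB; apply: derive1_ramp_delta => //; apply/andP.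
have rhs : - (\int[mu]_(x in `]0, 1[) (v x * ramp a n x) -
            \int[mu]_(x in `]0, 1[) (v x * ramp b n x)) @[n --> \oo] -->
   - (\int[mu]_(x in `]a, 1[) v x - \int[mu]_(x in `]b, 1[) v x).
  by apply: cvgN; apply: cvgB; apply: integral_ramp_cvg => //; exact: ltW.
have b1' : 0 < 1 - b by rewrite subr_gt0.
apply: (cvg_unique (@Rhausdorff R) lhs).
apply: cvg_trans rhs; apply: near_eq_cvg; near=> n.
have bn1 : b + n.+1%:R^-1 < 1.
  by rewrite -ltrBrDl; near: n; exact: near_infty_natSinv_lt (PosNum b1').
have mv : measurable_fun `](0 : R), 1[ v by apply/measurable_EFinP; case/integrableP : iv.
have mu_ : measurable_fun `](0 : R), 1[ u by apply/measurable_EFinP; case/integrableP : iu.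
have mc : measurable_fun `](0 : R), 1[ c.
  by apply/measurable_EFinP; case/integrableP : (continuous_integrable01 cc).
have ivr d : mu.-integrable `]0, 1[ (EFin \o (fun x => v x * ramp d n x)).
  apply: (le_integrable _ _ _ iv) => //.
    apply/measurable_EFinP; apply: measurable_funM => //.
    by apply: measurable_funTS; apply: continuous_measurable_fun; exact: continuous_ramp.
  by move=> x _ /=; rewrite lee_fin normrM ler_piMr// ramp_bounded.
have icr d : mu.-integrable `]0, 1[ (EFin \o (fun x => c x * ((ramp d n)^`())%classic x)).
  apply: continuous_integrable01 => x; apply: continuousM; first exact: cc.
  exact: (continuous_subspaceT (@continuous_derive1_ramp d n)).
rewrite -!RintegralB//.
have := uv _ (test_function_ramp a0 ab bn1).
have -> : ((fun x => ramp a n x - ramp b n x)^`())%classic =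
    fun x => ((ramp a n)^`())%classic x - ((ramp b n)^`())%classic x.
  apply/funext => x; rewrite !derive1E deriveB//;
    exact: (@smooth_term_derivable _ (ramp _ n) 0 _ (smooth_ramp _ n)).
move=> H; transitivity (- \int[mu]_(x in `]0, 1[) (v x * (ramp a n x - ramp b n x))).
  by congr (- _); apply: eq_Rintegral => x _; rewrite mulrBr.
pose T x := ((ramp a n)^`())%classic x - ((ramp b n)^`())%classic x.
rewrite -H -/T.
have mT : measurable_fun `](0 : R), 1[ T.
  by apply: measurable_funB; apply: measurable_funTS; apply: continuous_measurable_fun;
    exact: continuous_derive1_ramp.
transitivity (\int[mu]_(x in `]0, 1[) (c x * T x)).
  apply: ae_eq_Rintegral => //; first exact: measurable_funM.
    exact: measurable_funM.
  by move: uc; apply: ae_imply => x uc /= /uc ->.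
by apply: eq_Rintegral => x _; rewrite mulrBr.
Unshelve. all: by end_near. Qed.

(** By the previous lemma, c minus the primitive of v is constant on ]0, 1[; by
    continuity this constant is its value at 0. *)
Lemma weak_derivative_primitive (u v c : R -> R) :
  mu.-integrable `]0, 1[ (EFin \o u) -> mu.-integrable `[0, 1] (EFin \o v) ->
  {within `[0, 1], continuous c} ->
  {ae mu, forall x, x \in `]0, 1[ -> u x = c x} ->
  weak_derivative u v ->
  forall x, x \in `]0, 1[ -> c x = c 0 + \int[mu]_(s in `[0, x]) v s.
Proof.
move=> iu iv cc uc uv x; rewrite in_itv/= => /andP[x0 x1].
have iv' : mu.-integrable `]0, 1[ (EFin \o v).
  by apply: integrableS iv => //; exact: subset_itv_oo_cc.
pose V y := \int[mu]_(s in `[0, y]) v s.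
have tailE y : 0 <= y <= 1 -> \int[mu]_(s in `]y, 1[) v s = V 1 - V y.
  move=> /andP[y0 y1].
  rewrite Rintegral_itv_bndo_bndc; last first.
    apply: integrableS iv => //; apply: subset_itv; rewrite ?bnd_simp//.
  by rewrite /V Rintegral_itvB.
have cV : {within `[0, 1], continuous V}.
  exact: parameterized_integral_continuous.
have lim0 : (fun y => c y - V y) @ 0^'+ --> c 0 - V 0.
  apply: cvgB.
    by have /(continuous_within_itvP _ ltr01)[] := cc.
  by have /(continuous_within_itvP _ ltr01)[] := cV.
have limx : (fun y => c y - V y) @ 0^'+ --> c x - V x.
  apply: cvg_near_cst; near=> y.
  have y0 : 0 < y by near: y; exact: nbhs_right_gt.
  have yx : y < x by near: y; exact: nbhs_right_lt.
  have := weak_derivative_ramp iu iv' cc uc uv y0 (ltW yx) x1.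
  rewrite (tailE y) ?(ltW y0) ?(ltW (lt_trans yx x1))//.
  rewrite (tailE x) ?(ltW x0) ?(ltW x1)//; lra.
have := cvg_unique (@Rhausdorff R) lim0 limx.
rewrite [V 0]/V set_itv1 Rintegral_set1 subr0 => ->; rewrite -/(V x); ring.
Unshelve. all: by end_near. Qed.

End weak_derivatives.

(** * Functions whose primitive vanishes *)

Section reflected_profile.
Context {R : realType}.
Notation mu := (@lebesgue_measure R).

(** The primitive is continuous, so vanishing almost everywhere it vanishes
    everywhere; by Lebesgue's differentiation theorem its derivative, which is 0,
    equals k almost everywhere. *)
Lemma primitive_eq0_ae (k : R -> R) (T : R) : mu.-integrable setT (EFin \o k) ->
  {ae mu, forall x, x \in `]0, T[ -> \int[mu]_(s in `[0, x]) k s = 0} ->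
  {ae mu, forall x, x \in `]0, T[ -> k x = 0}.
Proof.
move=> ik [N [mN N0 HN]].
pose P x := \int[mu]_(s in `[0, x]) k s.
have ik' y : mu.-integrable `[0, y] (EFin \o k) by exact: integrable_subT ik.
have P0 x : x \in `]0, T[ -> P x = 0.
  rewrite in_itv/= => /andP[x0 xT]; apply: contrapT => /eqP Px0.
  have T0 := lt_trans x0 xT.
  have cP : {for x, continuous P}.
    have /(continuous_within_itvP _ T0)[+ _ _] :=
      parameterized_integral_continuous (ltW T0) (ik' T).
    by apply; rewrite in_itv/= x0.
  have nP : \forall y \near x, P y != 0.
    exact: (cP [set y | y != 0] (open_nbhs_nbhs _)).
  have nT : \forall y \near x, y \in `]0, T[.
    by near=> y; rewrite in_itv/=; apply/andP; split; near: y; [exact: lt_nbhsr|exact: lt_nbhsl].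
  have [e /= e0 eN] := filterI nP nT.
  have : (mu (ball x e) <= mu N)%E.
    apply: le_measure; rewrite ?inE//; first exact: measurable_ball.
    move=> y /eN[/eqP Py yT]; apply: HN => /= /(_ yT); exact: Py.
  rewrite N0 lebesgue_measure_ball ?(ltW e0)// lee_fin leNgt.
  by rewrite pmulrn_lgt0// e0.
have lk : locally_integrable setT k.
  exact: open_integrable_locally openT ik.
have := FTC1 ik' lk; apply: ae_imply => x /= + xT.
have /andP[x0 xT'] : 0 < x < T by move: xT; rewrite in_itv.
move=> H; have [|_ <-] := H; first by rewrite lte_fin.
rewrite derive1E (@near_eq_derive _ _ _ _ (cst 0)) ?derive_cst//.
by near=> y; rewrite [LHS]P0// in_itv/=; apply/andP; split; near: y; [exact: lt_nbhsr|exact: lt_nbhsl].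
Unshelve. all: by end_near. Qed.

(** * The boundary condition and the profile it generates *)

(** The argument is minus the wave g arriving at x = 1, the value is the wave f
    leaving it; the sign is changed because the profile is f on one side and - g
    on the other. *)
Definition boundary_law (b : R) : R :=
  if b < - 1 then - 2 - b else if 1 < b then 2 - b else b.

Lemma boundary_law0 : boundary_law 0 = 0.
Proof. by rewrite /boundary_law; do ! case: ltrP => ?; lra. Qed.

Lemma normr_boundary_law b : `|boundary_law b| <= `|b|.
Proof.
rewrite /boundary_law; case: ltrP => b1; first by rewrite [leRHS]ltr0_norm ?ler_norml; lra.
by case: ltrP => // b2; rewrite [leRHS]gtr0_norm ?ler_norml; lra.
Qed.

Lemma measurable_boundary_law : measurable_fun setT boundary_law.
Proof.
apply: measurable_fun_ifT; first exact: measurable_fun_ltr.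
  exact: measurable_funB.
apply: measurable_fun_ifT; first exact: measurable_fun_ltr.
  exact: measurable_funB.
by [].
Qed.

(** The pair (a, b) is obtained by rotating the point of the plane by 45 degrees.
    The left ray becomes a = b + 2 over b <= -1, the vertical segment becomes
    a = - b over [-1, 1], and the right ray becomes a = b - 2 over b >= 1: since a
    monotone curve is rotated, these pieces lie over consecutive intervals of b.
    The breakpoints are at -1 and 1 because M is the square root of 2. *)
Lemma sign_graph_boundary_law (a b : R) :
  sign_graph (Num.sqrt 2) ((a + b) / Num.sqrt 2, - ((a - b) / Num.sqrt 2)) <->
  a = boundary_law (- b).
Proof.
set s := Num.sqrt 2; have s0 : 0 < s by rewrite sqrtr_gt0.
have ss : s * s = 2 by rewrite -expr2 sqr_sqrtr.
have s_neq0 : s != 0 by rewrite gt_eqF.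
have XE : (a + b) / s * s = a + b by rewrite divfK.
have YE : - ((a - b) / s) * s = b - a by rewrite mulNr divfK// opprB.
set X := (a + b) / s in XE *; set Y := - _ in YE *.
have lawE : a = boundary_law (- b) <->
    (a + b <= 0 /\ b - a = - 2) \/ (a + b = 0 /\ - 2 <= b - a <= 2) \/
    (0 <= a + b /\ b - a = 2).
  rewrite /boundary_law; split.
    case: ltrP => ?; last case: ltrP => ?; move=> ->.
    - by right; right; split; lra.
    - by left; split; lra.
    - by right; left; split; [|apply/andP; split]; lra.
  by move=> [[? ?]|[[? /andP[? ?]]|[? ?]]]; do ! case: ltrP => ?; lra.
rewrite lawE -XE -YE -ss -mulNr /sign_graph/= !in_itv/= andbT.
have -> : (X * s <= 0) = (X <= 0) by rewrite pmulr_lle0.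
have -> : (0 <= X * s) = (0 <= X) by rewrite pmulr_lge0.
rewrite !ler_pM2r//; split.
- move=> [[[? ->]|[-> ?]]|[? ->]]; [by left|right; left|by right; right].
  by rewrite mul0r.
- move=> [[? /(mulIf s_neq0)]|[[/eqP + ?]|[? /(mulIf s_neq0)]]].
  + by left; left.
  + by rewrite mulf_eq0 (negbTE s_neq0) orbF => /eqP; left; right.
  + by right.
Qed.

(* initial values of the profile, extended by 0 *)
Variable F0 : R -> R.
Hypothesis F0_out : forall s, ~~ (- 1 < s < 1) -> F0 s = 0.

(** The equation F s = F0 s + law (F (s - 2)) can be unrolled: since F0 vanishes
    below -1, n unrollings determine F up to 2 n + 1. *)
Fixpoint profile_iter (n : nat) (s : R) : R :=
  if n is n'.+1 then F0 s + boundary_law (profile_iter n' (s - 2)) else F0 s.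

(** The number of unrollings is admissible because |s| < truncn |s| + 1. *)
Definition profile (s : R) : R := profile_iter (Num.truncn `|s|) s.

Lemma profile_iter_le n s : s <= - 1 -> profile_iter n s = 0.
Proof.
elim: n s => [|n IH] s s1 /=; first by rewrite F0_out// negb_and -!leNgt s1.
by rewrite F0_out ?IH ?boundary_law0 ?addr0//; [lra|rewrite negb_and -!leNgt s1].
Qed.

Lemma profile_iter_stable n m s : (n <= m)%N -> s <= 2 * n%:R + 1 ->
  profile_iter m s = profile_iter n s.
Proof.
elim: n m s => [|n IH] [|m] s //=.
  by move=> _ s1; rewrite profile_iter_le ?boundary_law0 ?addr0//; lra.
by move=> nm s1; rewrite (IH m)//; move: s1; rewrite -natr1; lra.
Qed.

Lemma profileE n s : s <= 2 * n%:R + 1 -> profile s = profile_iter n s.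
Proof.
move=> sn; rewrite /profile; set m := Num.truncn _.
have sm : s <= 2 * m%:R + 1.
  have : `|s| < m.+1%:R by rewrite /m truncnS_gt.
  have := ler_norm s; rewrite -natr1; have : 0 <= m%:R :> R by []. lra.
have [nm|mn] := leqP n m; first exact: profile_iter_stable.
by apply/esym/profile_iter_stable => //; exact: ltnW.
Qed.

Lemma profile_rec s : profile s = F0 s + boundary_law (profile (s - 2)).
Proof.
pose n := Num.truncn `|s|.
have sn : s - 2 <= 2 * n%:R + 1.
  have : `|s| < n.+1%:R by rewrite /n truncnS_gt.
  have := ler_norm s; rewrite -natr1; have : 0 <= n%:R :> R by []. lra.
rewrite (@profileE n.+1)/= ?(profileE sn)//; rewrite -natr1; lra.
Qed.

Lemma profile_init s : s < 1 -> profile s = F0 s.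
Proof. by move=> s1; rewrite (@profileE 0)// mulr0 add0r ltW. Qed.

Lemma profile_reflect s : 1 <= s -> profile s = boundary_law (profile (s - 2)).
Proof. by move=> s1; rewrite profile_rec F0_out ?add0r// negb_and -!leNgt s1 orbT. Qed.

Variable p : \bar R.
Hypothesis p1 : (1 <= p)%E.
Hypothesis F0_Lp : F0 \in Lfun mu p.

(** A translation preserves Lp, and so does the boundary law because it never
    increases absolute values. *)
Lemma profile_iter_Lfun n : profile_iter n \in Lfun mu p.
Proof.
elim: n => [//|n IH] /=; apply: Lfun_add => //.
have nL := Lfun_preserves_lebesgue p1 (preserves_lebesgue_shift (- 2)) IH.
apply: (@Lfun_dominated _ _ (boundary_law \o (profile_iter n \o (fun s => s + - 2))) _ p1 _ _ nL);
  last by move=> x; exact: normr_boundary_law.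
apply: measurableT_comp; first exact: measurable_boundary_law.
by move: nL; rewrite inE => /andP[]; rewrite inE.
Qed.

Lemma profile_Lp_on (D : set R) (T : R) : measurable D -> D `<=` `]-oo, T[ ->
  Lp_on p D profile.
Proof.
move=> mD DT; pose n := Num.truncn `|T|.
have nL := profile_iter_Lfun n.
rewrite /Lp_on (_ : profile \_ D = profile_iter n \_ D); last first.
  apply/funext => s; rewrite !patchE; case: ifPn => // /set_mem/DT/=.
  rewrite in_itv/= => sT; apply: profileE.
  have : `|T| < n.+1%:R by rewrite /n truncnS_gt.
  have := ler_norm T; rewrite -natr1; have : 0 <= n%:R :> R by []. lra.
apply: (Lfun_dominated p1 _ _ nL) => [|x]; last first.
  by rewrite patchE; case: ifPn => // _; rewrite normr0.
apply/(measurable_restrictT _ _).1 => //; apply: measurable_funTS.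
by move: nL; rewrite inE => /andP[]; rewrite inE.
Qed.

Lemma measurable_profile : measurable_fun setT profile.
Proof.
apply: (@measurable_fun_cvg _ _ _ _ profile_iter) => [n|s _].
  by have := profile_iter_Lfun n; rewrite inE => /andP[]; rewrite inE.
apply: cvg_near_cst; near=> n; apply/esym/profileE.
have : `|s| < n%:R by near: n; exact: nbhs_infty_gtr.
have := ler_norm s; have : 0 <= n%:R :> R by []. lra.
Unshelve. all: by end_near. Qed.

End reflected_profile.

(** * Existence *)

Section wave_equation.
Context {R : realType}.
Notation mu := (@lebesgue_measure R).

(** The half-open interval in the hypotheses allows integrands that are only
    controlled on an open half-line starting at a. *)
Lemma ae_eq_Rintegral_cc (f g : R -> R) (a b : R) :
  measurable_fun `]a, b] f -> measurable_fun `]a, b] g ->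
  {ae mu, forall x, a < x <= b -> f x = g x} ->
  \int[mu]_(x in `[a, b]) f x = \int[mu]_(x in `[a, b]) g x.
Proof.
move=> mf mg fg.
transitivity (\int[mu]_(x in `]a, b]) f x).
  by rewrite /Rintegral integral_itv_obnd_cbnd//; exact/measurable_EFinP.
transitivity (\int[mu]_(x in `]a, b]) g x).
  apply: ae_eq_Rintegral => //; move: fg; apply: ae_imply.
by rewrite /Rintegral integral_itv_obnd_cbnd//; exact/measurable_EFinP.
Qed.

Lemma ae_neq (a : R) : {ae mu, forall x, x != a}.
Proof.
exists [set a]; split; [exact: measurable_set1|exact: lebesgue_measure_set1|].
by move=> x /= /negP; rewrite negbK => /eqP.
Qed.

Lemma Lp_on_integrable (p : \bar R) (f : R -> R) (a b : R) : (1 <= p)%E ->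
  Lp_on p `]a, b[ f -> mu.-integrable setT (EFin \o (f \_ `]a, b[)).
Proof.
move=> p1 fL.
have fin : (@lebesgue_measure R `]a, b[ < +oo)%E.
  by rewrite lebesgue_measure_itv/=; case: ifP => _; rewrite -?EFinD ltry.
have := Lfun_integrable_finite p1 (measurable_itv _) fin fL.
move/(integrable_patch _ (measurable_itv _)).2.
by rewrite -patch_setI setIid.
Qed.

Lemma int_between_eq (f g : R -> R) (a y : R) : a <= 0 -> a <= y ->
  measurable_fun `]a, +oo[ f -> measurable_fun `]a, +oo[ g ->
  {ae mu, forall s, a < s -> f s = g s} ->
  int_between f 0 y = int_between g 0 y.
Proof.
move=> a0 ay mf mg fg; rewrite /int_between; case: ifP => y0.
  apply: ae_eq_Rintegral_cc; last first.
  - by move: fg; apply: ae_imply => x fg /andP[x0 _]; exact/fg/(le_lt_trans a0).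
  - by apply: measurable_funS mg => // x /=; rewrite !in_itv/= andbT => /andP[x0 _]; exact: le_lt_trans x0.
  - by apply: measurable_funS mf => // x /=; rewrite !in_itv/= andbT => /andP[x0 _]; exact: le_lt_trans x0.
congr (- _).
apply: ae_eq_Rintegral_cc; last first.
- by move: fg; apply: ae_imply => x fg /andP[x0 _]; exact/fg/(le_lt_trans ay).
- by apply: measurable_funS mg => // x /=; rewrite !in_itv/= andbT => /andP[x0 _]; exact: le_lt_trans x0.
- by apply: measurable_funS mf => // x /=; rewrite !in_itv/= andbT => /andP[x0 _]; exact: le_lt_trans x0.
Qed.

Lemma Rintegral_opp (g : R -> R) (x : R) : mu.-integrable `[- x, 0] (EFin \o g) ->
  \int[mu]_(s in `[- x, 0]) g s = \int[mu]_(s in `[0, x]) g (- s).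
Proof.
move=> ig; rewrite -(preserves_lebesgue_Rintegral (@preserves_lebesgue_opp R) _ ig)//.
congr (Rintegral _ _ _); apply/seteqP; split => s /=; rewrite !in_itv/=; lra.
Qed.

Lemma Rintegral_cc_patch (h : R -> R) (c T a b : R) :
  measurable_fun `]c, +oo[ h -> c <= a -> b < T ->
  \int[mu]_(s in `[a, b]) h s = \int[mu]_(s in `[a, b]) (h \_ `]c, T[) s.
Proof.
move=> mh ca bT; apply: ae_eq_Rintegral_cc.
- by apply: measurable_funS mh => // x /=; rewrite !in_itv/= andbT => /andP[ax _]; exact: le_lt_trans ax.
- apply: measurable_funTS; apply/(measurable_restrictT _ _).1 => //.
  by apply: measurable_funS mh => // x /=; rewrite !in_itv/= andbT => /andP[].
- apply: aeW => x /andP[ax xb]; rewrite patchE mem_set//= in_itv/=.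
  by rewrite (le_lt_trans ca ax) (le_lt_trans xb bT).
Qed.

Lemma Lp_on_opp (p : \bar R) (f : R -> R) (a b : R) : (1 <= p)%E ->
  Lp_on p `]a, b[ f -> Lp_on p `](- b), (- a)[ (f \o -%R).
Proof.
move=> p1 /(Lfun_preserves_lebesgue p1 (@preserves_lebesgue_opp R)).
have -> // : (f \_ `]a, b[) \o -%R = (f \o -%R) \_ `](- b), (- a)[.
apply/funext => x /=; rewrite !patchE; congr (if _ then _ else _).
by apply/idP/idP; rewrite !inE/= !in_itv/=; lra.
Qed.

(** At time 0 a solution satisfies F s + F (- s) = sqrt 2 * v s and
    F s - F (- s) = sqrt 2 * w s on ]0, 1[, where v is the derivative of the initial
    position and w the initial velocity. For v and w vanishing outside ]0, 1[ the
    formula solves these two equations on both sides of 0 at once. *)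
Definition initial_profile (v w : R -> R) (s : R) : R :=
  (Num.sqrt 2)^-1 * (v s + v (- s) + (w s - w (- s))).

Section given_data.
Variables (p : \bar R) (p1 : (1 <= p)%E) (v w : R -> R).
Hypotheses (vL : v \in Lfun mu p) (wL : w \in Lfun mu p).
Hypotheses (v_out : forall s, ~~ (0 < s < 1) -> v s = 0)
           (w_out : forall s, ~~ (0 < s < 1) -> w s = 0).

Notation F0 := (initial_profile v w).
Notation F := (profile F0).

Lemma initial_profile_out s : ~~ (- 1 < s < 1) -> F0 s = 0.
Proof.
move=> s1; have h1 : ~~ (0 < s < 1) by apply: contra s1 => /andP[? ?]; apply/andP; split; lra.
have h2 : ~~ (0 < - s < 1) by apply: contra s1 => /andP[? ?]; apply/andP; split; lra.
by rewrite /initial_profile !v_out// !w_out// subrr !addr0 mulr0.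
Qed.

Lemma initial_profile_Lfun : F0 \in Lfun mu p.
Proof.
have opp := Lfun_preserves_lebesgue p1 (@preserves_lebesgue_opp R).
apply: Lfun_mull => //; apply: Lfun_add => //; apply: Lfun_add => //.
- exact: opp.
- rewrite (_ : (fun _ => _) = fun x => -1 * (w \o -%R) x).
    by apply: Lfun_mull => //; exact: opp.
  by apply/funext => x; rewrite mulN1r.
Qed.

Lemma profile_even s : 0 <= s -> s < 1 -> F s + F (- s) = Num.sqrt 2 * v s.
Proof.
move=> s0 s1; rewrite !(profile_init initial_profile_out)//; last by lra.
have ss : Num.sqrt 2 * Num.sqrt 2 = 2 :> R by rewrite -expr2 sqr_sqrtr.
have s_neq0 : Num.sqrt 2 != 0 :> R by rewrite gt_eqF// sqrtr_gt0.
rewrite /initial_profile opprK [v (- s)]v_out; last by apply/negP => /andP[]; lra.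
apply: (mulfI s_neq0); rewrite -mulrDr mulVKf// [RHS]mulrA ss; ring.
Qed.

Lemma profile_odd s : 0 <= s -> s < 1 -> F s - F (- s) = Num.sqrt 2 * w s.
Proof.
move=> s0 s1; rewrite !(profile_init initial_profile_out)//; last by lra.
have ss : Num.sqrt 2 * Num.sqrt 2 = 2 :> R by rewrite -expr2 sqr_sqrtr.
have s_neq0 : Num.sqrt 2 != 0 :> R by rewrite gt_eqF// sqrtr_gt0.
rewrite /initial_profile opprK [w (- s)]w_out; last by apply/negP => /andP[]; lra.
apply: (mulfI s_neq0); rewrite -mulrBr mulVKf// [RHS]mulrA ss; ring.
Qed.

Lemma data_profile_Lp (D : set R) (T : R) : measurable D -> D `<=` `]-oo, T[ -> Lp_on p D F.
Proof. exact: profile_Lp_on initial_profile_out _ p1 initial_profile_Lfun _ _. Qed.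

Lemma data_profile_integrable (a b : R) : mu.-integrable `[a, b] (EFin \o F).
Proof.
have /(Lp_on_integrable p1)/integrable_patch : Lp_on p `]a - 1, b + 1[ F.
  apply: (@data_profile_Lp _ (b + 1)) => // x /=; rewrite !in_itv/=; lra.
move=> /(_ (measurable_itv _)); apply: integrableS => //.
by move=> x /=; rewrite !in_itv/=; lra.
Qed.

Lemma measurable_data_profile : measurable_fun setT F.
Proof. exact: measurable_profile initial_profile_out _ p1 initial_profile_Lfun. Qed.

Definition profile_wave (t x : R) : R :=
  (Num.sqrt 2)^-1 * int_between F 0 (t + x) +
  (Num.sqrt 2)^-1 * int_between (\- F) 0 (t - x).

Lemma Rintegral_opp_data_profile (a b : R) :
  \int[mu]_(s in `[a, b]) (\- F) s = - \int[mu]_(s in `[a, b]) F s.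
Proof.
rewrite -mulN1r -RintegralZl//; last exact: data_profile_integrable.
by apply: eq_Rintegral => s _; rewrite mulN1r.
Qed.

(** The choice g = - F is forced by the Dirichlet condition at x = 0, and turns
    the condition at x = 1 into F (t + 1) = law (F (t - 1)), the equation that
    defines the profile. *)
Lemma profile_wave_solution (z0 z1 : R -> R) :
  {ae mu, forall x, x \in `]0, 1[ -> z0 x = \int[mu]_(s in `[0, x]) v s} ->
  (forall x, 0 < x < 1 -> z1 x = w x) ->
  wave_solution p (sign_graph (Num.sqrt 2)) z0 z1 profile_wave.
Proof.
move=> z0v z1w.
have s0 : 0 < Num.sqrt 2 :> R by rewrite sqrtr_gt0.
have s_neq0 : Num.sqrt 2 != 0 :> R by rewrite gt_eqF.
exists F, (\- F); split => //.
- split; split.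
  + exact: measurable_funTS measurable_data_profile.
  + move=> T _; apply: (@data_profile_Lp _ T) => // x /=; rewrite !in_itv/=; lra.
  + by apply: measurable_funN; exact: measurable_funTS measurable_data_profile.
  + move=> T _; rewrite /Lp_on (_ : _ \_ _ = fun s => -1 * (F \_ `]-1, T[) s).
      apply: Lfun_mull => //; apply: (@data_profile_Lp _ T) => // x /=; rewrite !in_itv/=; lra.
    by apply/funext => x; rewrite !patchE; case: ifP => _; rewrite mulN1r ?oppr0.
- apply: aeW => t; rewrite in_itv/= andbT => t0; split.
    by rewrite /profile_wave addr0 subr0 /int_between t0 Rintegral_opp_data_profile mulrN subrr.
  rewrite /wave_dt /wave_dx sign_graph_boundary_law opprK (profile_reflect initial_profile_out).
    by congr (boundary_law (F _)); ring.
  by lra.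
- apply: (ae_imply2 _ (ae_neq 0) (ae_imply2 (fun x => @conj _ _) (ae_neq 1) z0v)).
  move=> x x0 [x1 z0x]; rewrite in_itv/= !le_eqVlt eq_sym (negbTE x0) (negbTE x1)/= => x01.
  have /andP[{}x0 {}x1] := x01.
  rewrite z0x ?in_itv//; split; last first.
    rewrite /wave_dt add0r sub0r profile_odd ?(ltW x0)// z1w//.
    by rewrite mulrC mulKf.
  rewrite /profile_wave add0r sub0r /int_between (ltW x0) leNgt oppr_lt0 x0/=.
  rewrite Rintegral_opp_data_profile opprK Rintegral_opp; last exact: data_profile_integrable.
  have iv : mu.-integrable `[0, x] (EFin \o v).
    apply: Lfun_integrable_finite p1 _ _ vL => //.
    by rewrite lebesgue_measure_itv/= lte_fin x0 -EFinD ltry.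
  transitivity ((Num.sqrt 2)^-1 * (Num.sqrt 2 * \int[mu]_(s in `[0, x]) v s));
    last by rewrite mulKf.
  rewrite -mulrDr; congr (_ * _); rewrite -RintegralZl//.
  have -> : \int[mu]_(s in `[0, x]) F (- s) =
      \int[mu]_(s in `[0, x]) (Num.sqrt 2 * v s) - \int[mu]_(s in `[0, x]) F s.
    rewrite -RintegralB//; [|exact: integrableZl iv|exact: data_profile_integrable].
    apply: eq_Rintegral => s; rewrite inE/= in_itv/= => /andP[s0' sx].
    by rewrite -profile_even ?(le_lt_trans sx)//; ring.
  by rewrite addrC subrK.
Qed.

(** * Uniqueness *)

(** Each condition is differentiated to an almost-everywhere identity between f
    and g: the Dirichlet condition gives g = - f on the positive half-line, the
    initial conditions determine f on ]0, 1[ and g on ]-1, 0[, and the condition at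
    x = 1 gives f at s from g at s - 2. By induction f and - g coincide almost
    everywhere with the profile on intervals whose length grows by 2. *)
Lemma profile_wave_unique (z0 z1 : R -> R) (z : R -> R -> R) :
  {ae mu, forall x, x \in `]0, 1[ -> z0 x = \int[mu]_(s in `[0, x]) v s} ->
  (forall x, 0 < x < 1 -> z1 x = w x) ->
  wave_solution p (sign_graph (Num.sqrt 2)) z0 z1 z ->
  forall t x, 0 <= t -> 0 <= x <= 1 -> z t x = profile_wave t x.
Proof.
move=> z0v z1w [f [g [[[mf fL] [mg gL]] zE bc ic]]].
have s0 : 0 < Num.sqrt 2 :> R by rewrite sqrtr_gt0.
have s_neq0 : Num.sqrt 2 != 0 :> R by rewrite gt_eqF.
have if_ T : 0 < T -> mu.-integrable setT (EFin \o (f \_ `]0, T[)).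
  by move=> T0; exact: Lp_on_integrable p1 (fL _ T0).
have ig_ T : -1 < T -> mu.-integrable setT (EFin \o (g \_ `]-1, T[)).
  by move=> T0; exact: Lp_on_integrable p1 (gL _ T0).
have fg : {ae mu, forall s, 0 < s -> g s = - f s}.
  (* local version: the primitive of f + g over [0, t] is sqrt 2 * z t 0 *)
  have fgn (n : nat) : {ae mu, forall s, s \in `]0, n.+1%:R[ ->
      (f \_ `]0, n.+1%:R[) s + (g \_ `]-1, n.+1%:R[) s = 0}.
    have n0 : 0 < n.+1%:R :> R by [].
    have n1 : -1 < n.+1%:R :> R by apply: lt_trans n0; lra.
    apply: primitive_eq0_ae; first exact: integrableD (if_ _ n0) (ig_ _ n1).
    move: bc; apply: ae_imply => t bc; rewrite in_itv/= => /andP[t0 tn].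
    have t0' : t \in `[0, +oo[ by rewrite in_itv/= ltW.
    have [zt0 _] := bc t0'.
    have := zt0; rewrite zE ?in_itv/= ?(ltW t0) ?lexx ?ler01// addr0 subr0.
    rewrite /int_between (ltW t0) (Rintegral_cc_patch mf (lexx 0) tn).
    rewrite (@Rintegral_cc_patch g (-1) n.+1%:R 0 t)//.
    rewrite -mulrDr -RintegralD//; last 2 first.
    - exact: integrable_subT (if_ _ n0).
    - exact: integrable_subT (ig_ _ n1).
    by move/eqP; rewrite mulf_eq0 invr_eq0 (negbTE s_neq0)/= => /eqP.
  move: (ae_forall_nat fgn); apply: ae_imply => s fgs ss.
  have sn := truncnS_gt s; have := fgs (Num.truncn s); rewrite in_itv/= ss sn => /(_ isT).
  rewrite !patchE !mem_set/= ?in_itv/= ?ss ?sn//; first by move=> ?; lra.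
  by rewrite andbT; lra.
have init : {ae mu, forall s, s \in `]0, 1[ -> f s = F s /\ g (- s) = - F (- s)}.
  have ikf := if_ 1 ltr01.
  have vv : v \_ `]0, 1[ = v.
    apply/funext => s; rewrite patchE; case: ifPn => //.
    by rewrite notin_setE/= in_itv/= => /negP /v_out.
  have ikv : mu.-integrable setT (EFin \o v).
    by rewrite -vv; apply: (Lp_on_integrable p1); rewrite /Lp_on vv.
  have gL1 : Lp_on p `]-1, 1[ g by apply: gL; lra.
  have ikg : mu.-integrable setT (EFin \o ((g \o -%R) \_ `]-1, 1[)).
    by apply: (Lp_on_integrable p1); have := Lp_on_opp p1 gL1; rewrite opprK.
  have ig1 : mu.-integrable `]-1, 1[ (EFin \o g).
    exact/(integrable_patch _ _).1/(Lp_on_integrable p1).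
  (* the primitive of k over [0, x] is sqrt 2 * (z 0 x - z0 x) *)
  pose k s := (f \_ `]0, 1[) s - ((g \o -%R) \_ `]-1, 1[) s - Num.sqrt 2 * v s.
  have ik12 : mu.-integrable setT
      (EFin \o (fun s => (f \_ `]0, 1[) s - ((g \o -%R) \_ `]-1, 1[) s)).
    exact: (integrableB _ ikf ikg).
  have ikv2 : mu.-integrable setT (EFin \o (fun s => Num.sqrt 2 * v s)).
    exact: (integrableZl _ _ ikv).
  have k0 : {ae mu, forall s, s \in `]0, 1[ -> k s = 0}.
    apply: primitive_eq0_ae; first exact: (integrableB _ ik12 ikv2).
    apply: (ae_imply2 _ z0v ic) => x z0x icx x01; have := x01.
    rewrite in_itv/= => /andP[x0 x1].
    have x01' : x \in `[0, 1] by rewrite in_itv/= !ltW.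
    have [zx _] := icx x01'.
    rewrite RintegralB//; [|exact: integrable_subT ik12|exact: integrable_subT ikv2].
    rewrite RintegralB//; [|exact: integrable_subT ikf|exact: integrable_subT ikg].
    rewrite RintegralZl//; last exact: integrable_subT ikv.
    rewrite -(z0x x01) -zx zE ?in_itv/= ?lexx ?ltW// add0r sub0r -mulrDr mulVKf//.
    rewrite /int_between (ltW x0) leNgt oppr_lt0 x0/=.
    rewrite Rintegral_opp; last first.
      by apply: integrableS ig1 => // y /=; rewrite !in_itv/=; lra.
    rewrite -(Rintegral_cc_patch mf (lexx 0) x1).
    have -> : \int[mu]_(s in `[0, x]) ((g \o -%R) \_ `]-1, 1[) s =
              \int[mu]_(s in `[0, x]) g (- s).
      apply: eq_Rintegral => s; rewrite inE/= in_itv/= => /andP[s1 s2].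
      by rewrite patchE mem_set//= in_itv/=; lra.
    by rewrite subrr.
  apply: (ae_imply2 _ k0 ic) => s ks ics s01; have := s01.
  rewrite in_itv/= => /andP[s1 s2].
  have s01' : s \in `[0, 1] by rewrite in_itv/= !ltW.
  have [_] := ics s01'.
  rewrite /wave_dt add0r sub0r z1w ?s1// => /(congr1 (fun y => y * Num.sqrt 2)).
  rewrite divfK// => e1; have := ks s01; rewrite /k !patchE !mem_set//=; last by rewrite in_itv/=; lra.
  have := profile_even (ltW s1) s2; have := profile_odd (ltW s1) s2.
  by move: e1; rewrite [w s * _]mulrC; split; lra.
have bdry : {ae mu, forall s, 1 <= s -> f s = boundary_law (- g (s - 2))}.
  have := preserves_lebesgue_ae (preserves_lebesgue_shift (- 1)) bc.
  apply: ae_imply => s bcs s1.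
  have s1' : s + -1 \in `[0, +oo[ by rewrite in_itv/= andbT; lra.
  have [_] := bcs s1'.
  rewrite /wave_dt /wave_dx sign_graph_boundary_law.
  by rewrite subrK -addrA -opprD.
have ind n : {ae mu, forall s, -1 < s < 2 * n%:R + 1 ->
    (0 < s -> f s = F s) /\ g s = - F s}.
  elim: n => [|n IH].
    have initN := preserves_lebesgue_ae (@preserves_lebesgue_opp R) init.
    apply: (ae_imply2 _ (ae_imply2 (fun x => @conj _ _) init initN)
      (ae_imply2 (fun x => @conj _ _) fg (ae_neq 0))).
    move=> s [ins insN] [fgs sn0]; rewrite mulr0 add0r => /andP[s1 s2].
    have [ss|ss|/eqP] := ltgtP s 0; last by rewrite (negbTE sn0).
    - split; first by move=> h; exfalso; lra.
      have s01 : - s \in `]0, 1[ by rewrite in_itv/=; lra.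
      by have [_] := insN s01; rewrite opprK.
    - have s01 : s \in `]0, 1[ by rewrite in_itv/= ss s2.
      have [fs _] := ins s01.
      by split=> // ; rewrite fgs// fs.
  have IH2 := preserves_lebesgue_ae (preserves_lebesgue_shift (- 2)) IH.
  apply: (ae_imply2 _ (ae_imply2 (fun x => @conj _ _) IH IH2)
    (ae_imply2 (fun x => @conj _ _) fg (ae_imply2 (fun x => @conj _ _) bdry (ae_neq 1)))).
  move=> s [IHs IHs2] [fgs [bs sn1]] /andP[s1 sn].
  (* s = 1 is excluded since s - 2 = -1 is outside the domain of g *)
  have [sn'|ns] := ltP s (2 * n%:R + 1); first by apply: IHs; rewrite s1.
  have n0 : 0 <= n%:R :> R by [].
  have s_gt1 : 1 < s by rewrite lt_neqAle eq_sym sn1/=; lra.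
  have s2n : -1 < s + -2 < 2 * n%:R + 1 by move: sn; rewrite -natr1; lra.
  have [_ gs2] := IHs2 s2n.
  have fs : f s = F s.
    rewrite bs ?(ltW s_gt1)// gs2 opprK.
    by rewrite [RHS](profile_reflect initial_profile_out)// ltW.
  by split => //; rewrite fgs ?fs//; lra.
have {}ind : {ae mu, forall s, -1 < s -> (0 < s -> f s = F s) /\ g s = - F s}.
  move: (ae_forall_nat ind); apply: ae_imply => s inds s1.
  apply: (inds (Num.truncn `|s|)); rewrite s1/=.
  have := truncnS_gt `|s|; have := ler_norm s; rewrite -natr1.
  have : 0 <= (Num.truncn `|s|)%:R :> R by [].
  lra.
have fF : {ae mu, forall s, 0 < s -> f s = F s}.
  move: ind; apply: ae_imply => s inds ss.
  have s1 : -1 < s by lra.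
  by have [/(_ ss)] := inds s1.
have gF : {ae mu, forall s, -1 < s -> g s = - F s}.
  by move: ind; apply: ae_imply => s inds /inds[].
move=> t x t0 /andP[x0 x1].
rewrite zE ?in_itv/= ?t0 ?x0//; congr (_ * _ + _ * _).
- apply: (@int_between_eq _ _ 0) => //; first exact: addr_ge0.
  exact: measurable_funTS measurable_data_profile.
- apply: (@int_between_eq _ _ (-1)) => //; [lra|].
  by apply: measurable_funN; exact: measurable_funTS measurable_data_profile.
Qed.

End given_data.
End wave_equation.

(** * Well-posedness *)

Lemma W1p_star_primitive (R : realType) (p : \bar R) (u : R -> R) : (1 <= p)%E ->
  W1p_star p u -> exists2 v : R -> R, Lp_on p `]0, 1[ v &
  {ae @lebesgue_measure R, forall x, x \in `]0, 1[ ->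
    u x = \int[@lebesgue_measure R]_(s in `[0, x]) (v \_ `]0, 1[) s}.
Proof.
move=> p1 [uL [v vL uv] [c [cc uc c0]]]; exists v => //.
have iu := (integrable_patch _ (measurable_itv _)).1 (Lp_on_integrable p1 uL).
have iv : (@lebesgue_measure R).-integrable `[0, 1] (EFin \o v \_ `]0, 1[).
  exact: integrable_subT (Lp_on_integrable p1 vL).
have uv' : weak_derivative u (v \_ `]0, 1[).
  move=> phi tphi; rewrite uv//; congr (- _); apply: eq_Rintegral => x x01.
  by rewrite patchE x01.
move: (uc); apply: ae_imply => x ux x01.
by rewrite ux// (weak_derivative_primitive iu iv cc uc uv')// c0 add0r.
Qed.

Unset Implicit Arguments.

Theorem proposition67 (R : realType) (p : \bar R) (hp : (1 <= p)%E)
    (z0 z1 : R -> R) (hz : Xspace p (z0, z1)) :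
  exists z : R -> R -> R,
    wave_solution p (sign_graph (Num.sqrt 2)) z0 z1 z /\
    forall w : R -> R -> R,
      wave_solution p (sign_graph (Num.sqrt 2)) z0 z1 w ->
      forall t x : R, t \in `[0, +oo[ -> x \in `[0, 1] -> w t x = z t x.
Proof.
have [/= /(W1p_star_primitive hp)[v vL z0v] z1L] := hz.
have out (h : R -> R) s : ~~ (0 < s < 1) -> (h \_ `]0, 1[) s = 0.
  by move=> s01; rewrite patchE memNset//= in_itv/=; exact/negP.
have z1E x : 0 < x < 1 -> z1 x = (z1 \_ `]0, 1[) x.
  by move=> x01; rewrite patchE mem_set//= in_itv.
exists (profile_wave (v \_ `]0, 1[) (z1 \_ `]0, 1[)); split.
  exact: (profile_wave_solution hp vL z1L (out v) (out z1) z0v z1E).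
move=> w solw t x; rewrite !in_itv/= andbT => t0 x01.
exact: (profile_wave_unique hp vL z1L (out v) (out z1) z0v z1E solw).
Qed.
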